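(* Assume conditions A, D' and E' hold for the semi-Markov processes $\eta^{(\varepsilon)}(t)$, $\varepsilon\in(0,\varepsilon_0]$, together with the paper's standing regularity conditions on the semi-Markov kernels, and let $\delta^*=\min_{i\in\mathbb{X},\,j\in\mathbb{Y}_i}(\delta_{ij}\wedge\dot\delta_{ij})$. Then for every $i\in\mathbb{X}$ the stationary probability $\pi_i(\varepsilon)$ admits a pivotal Taylor expansion with a power-type remainder bound of exponent $\delta^*$: there exist integers $0\le n^-_i\le n^+_i$, reals $c_i[l]$, $n^-_i\le l\le n^+_i$, with $c_i[n^-_i]\ne0$, and constants $G^*_i\in(0,\infty)$, $\varepsilon_i\in(0,\varepsilon_0]$ such that $\big|\pi_i(\varepsilon)-\sum_{l=n^-_i}^{n^+_i}c_i[l]\varepsilon^l\big|\le G^*_i\varepsilon^{n^+_i+\delta^*}$ for $0<\varepsilon\le\varepsilon_i$.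
   Context: Let $\mathbb{X}=\{1,\dots,N\}$, $0<\varepsilon_0\le1$. For each $\varepsilon\in(0,\varepsilon_0]$, $\eta^{(\varepsilon)}(t)$ is a semi-Markov process on $\mathbb{X}$ with jump times $0=\tau_0<\tau_1<\cdots$, embedded Markov chain $\eta_n=\eta^{(\varepsilon)}(\tau_n)$, sojourn times $\kappa_{n+1}=\tau_{n+1}-\tau_n$ and semi-Markov transition probabilities $Q^{(\varepsilon)}_{ij}(t)=P(\eta_{n+1}=j,\kappa_{n+1}\le t\mid\eta_n=i)$; $p_{ij}(\varepsilon)=Q^{(\varepsilon)}_{ij}(\infty)$ and $e_{ij}(\varepsilon)=\int_0^\infty t\,Q^{(\varepsilon)}_{ij}(dt)$ (finite). The paper also assumes standing regularity conditions on $Q^{(\varepsilon)}_{ij}$ guaranteeing a well-defined process with finite $e_{ij}$. Let $e_i(\varepsilon)=\sum_{j\in\mathbb{X}}e_{ij}(\varepsilon)$ (expected sojourn time in $i$), $E_{ii}(\varepsilon)$ the expectation of $\tau_{\nu_i}$, $\nu_i=\min\{n\ge1:\eta_n=i\}$, for the process started at $\eta_0=i$, and $\pi_i(\varepsilon)=e_i(\varepsilon)/E_{ii}(\varepsilon)$, the stationary (long-run time-average) probability of state $i$. Condition A: there are nonempty $\mathbb{Y}_i\subseteq\mathbb{X}$ with (a) $p_{ij}(\varepsilon)>0$ for $j\in\mathbb{Y}_i$; (b) $p_{ij}(\varepsilon)=0$ for $j\notin\mathbb{Y}_i$; (c) for all $i,j$ there are $n\ge1$ and $i=l_0,\dots,l_n=j$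 with $l_m\in\mathbb{Y}_{l_{m-1}}$. Condition D': for $j\in\mathbb{Y}_i$, $p_{ij}(\varepsilon)=\sum_{l=l^-_{ij}}^{l^+_{ij}}a_{ij}[l]\varepsilon^l+o_{ij}(\varepsilon)$ with integers $0\le l^-_{ij}\le l^+_{ij}$, $a_{ij}[l^-_{ij}]>0$, $|o_{ij}(\varepsilon)|\le G_{ij}\varepsilon^{l^+_{ij}+\delta_{ij}}$ for $0<\varepsilon\le\varepsilon_{ij}$, $\delta_{ij}\in(0,1]$, $G_{ij}\in(0,\infty)$, $\varepsilon_{ij}\in(0,\varepsilon_0]$. Condition E': for $j\in\mathbb{Y}_i$, $e_{ij}(\varepsilon)=\sum_{l=m^-_{ij}}^{m^+_{ij}}b_{ij}[l]\varepsilon^l+\dot o_{ij}(\varepsilon)$ with integers $m^-_{ij}\le m^+_{ij}$, $b_{ij}[m^-_{ij}]>0$, $|\dot o_{ij}(\varepsilon)|\le\dot G_{ij}\varepsilon^{m^+_{ij}+\dot\delta_{ij}}$ for $0<\varepsilon\le\dot\varepsilon_{ij}$, $\dot\delta_{ij}\in(0,1]$, $\dot G_{ij}\in(0,\infty)$, $\dot\varepsilon_{ij}\in(0,\varepsilon_0]$. *)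

(* Defs.v *)
From HB Require Import structures.
From mathcomp Require Import all_boot all_order all_algebra.
From mathcomp Require Import all_classical all_reals all_analysis.
Set Implicit Arguments. Unset Strict Implicit. Unset Printing Implicit Defensive.
Import Order.TTheory GRing.Theory Num.Theory.
Import numFieldNormedType.Exports.
Local Open Scope ring_scope.

(* States X = {1,...,N} are represented by 'I_N.
   For a fixed epsilon, P : 'I_N -> 'I_N -> R are the transition probabilities
   p_ij of the embedded Markov chain and Em : 'I_N -> 'I_N -> R the quantities
   e_ij = \int_0^oo t Q_ij(dt). *)

Definition esoj (N : nat) (R : realType) (Em : 'I_N -> 'I_N -> R) (i : 'I_N) : R :=
  \sum_(j < N) Em i j.

(* taboo (P i n k) = P_i( eta_n = k, eta_1 <> i, ..., eta_n <> i ),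
   for the embedded chain started at eta_0 = i
   (for n = 0 this is the indicator of k = i). *)
Fixpoint taboo (N : nat) (R : realType) (P : 'I_N -> 'I_N -> R) (i : 'I_N)
  (n : nat) (k : 'I_N) : R :=
  match n with
  | 0 => (k == i)%:R
  | n'.+1 => (k != i)%:R * \sum_(m < N) taboo P i n' m * P m k
  end.

(* E_ii = E_i tau_{nu_i} = \sum_{n >= 0} E_i [kappa_{n+1} ; nu_i >= n+1]
        = \sum_{n >= 0} \sum_k P_i(eta_n = k, nu_i > n) e_k ,
   using the Markov renewal property (conditionally on eta_n = k, the
   sojourn kappa_{n+1} has E = \sum_j e_kj = e_k). *)
Definition ret_time (N : nat) (R : realType) (P Em : 'I_N -> 'I_N -> R)
  (i : 'I_N) : R :=
  limn (series ((fun n => \sum_(k < N) taboo P i n k * esoj Em k) : R ^nat)).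

Definition stat_prob (N : nat) (R : realType) (P Em : 'I_N -> 'I_N -> R)
  (i : 'I_N) : R :=
  esoj Em i / ret_time P Em i.

(* delta^* = min over i in X, j in Y_i of (delta_ij /\ dot delta_ij);
   all delta's lie in (0,1], so 1 is a neutral start. *)
Definition delta_star (N : nat) (R : realType) (Y : 'I_N -> {set 'I_N})
  (d dd : 'I_N -> 'I_N -> R) : R :=
  \big[Num.min/1]_(i < N) \big[Num.min/1]_(j in Y i) Num.min (d i j) (dd i j).

(* Main.v *)
Require Import Defs.
From HB Require Import structures.
From mathcomp Require Import all_boot all_order all_algebra.
From mathcomp Require Import all_classical all_reals all_analysis.
From mathcomp Require Import ring lra.
Set Implicit Arguments. Unset Strict Implicit. Unset Printing Implicit Defensive.
Import Order.TTheory GRing.Theory Num.Theory.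
Import numFieldNormedType.Exports.
Local Open Scope ring_scope.

(* Call f pivotal of order n when f x = c x^n (1 + O(x^delta)) as x -> 0+,
   with c > 0 and delta = delta^*.  Products and quotients of pivotal
   functions are pivotal, and so are sums, since positive leading
   coefficients cannot cancel.  By D' and E', p_ij and e_ij are pivotal on the
   edges of Y and vanish elsewhere.
   E_ii = e_i + sum_{k <> i} p_ik h_k, where h solves the taboo system
   h = e + P h on X \ {i}.  Solve it by eliminating one state r at a time
   (censoring the chain): by condition A every set of states can be left with
   non-negligible probability, so each pivot 1 - p_rr stays pivotal, and in
   the end every h_k is pivotal.  Hence pi_i = (1 + sum_k p_ik h_k / e_i)^-1
   is pivotal of some order n >= 0: this is the asserted expansion, with
   n^- = n^+ = n. *)

Section NearZero.
Variable R : realType.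

Lemma near_at_right0 (e : R) (P : R -> Prop) : 0 < e ->
  (forall x, 0 < x <= e -> P x) -> \forall x \near at_right 0, P x.
Proof.
move=> e0 eP; near=> x; apply: eP; apply/andP; split; near: x;
  [exact: nbhs_right_gt | exact: nbhs_right_le].
Unshelve. all: by end_near. Qed.

Lemma near_at_right0P (P : R -> Prop) : (\forall x \near at_right 0, P x) ->
  exists2 e : R, 0 < e & forall x, 0 < x <= e -> P x.
Proof.
rewrite near_withinE => /nbhs_ballP[e /= e0 eP]; exists (e / 2); first by rewrite divr_gt0.
move=> x /andP[x0 xe]; apply: (eP _ _ x0).
have x_lt_e : x < e by rewrite (le_lt_trans xe) // ltr_pdivrMr // ltr_pMr // ltr1n.
by rewrite /ball /= sub0r normrN gtr0_norm.
Qed.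

Lemma near_forall_in (I : finType) (A : {pred I}) (P : I -> R -> Prop) :
  (forall k, k \in A -> \forall x \near at_right 0, P k x) ->
  \forall x \near at_right 0, forall k, k \in A -> P k x.
Proof.
move=> HA; apply: filter_forall => k; case: (boolP (k \in A)) => [/HA|kA].
  by apply: filterS => x Px _.
by apply: nearW => x kA'; case/negP: kA.
Qed.

Lemma near0_unit : \forall x \near at_right (0 : R), 0 < x <= 1.
Proof. exact: near_at_right0 ltr01 _. Qed.

Lemma powR_le1 (d x : R) : 0 <= d -> 0 < x <= 1 -> x `^ d <= 1.
Proof. by move=> d0 x01; rewrite -(powRr0 x); exact: ger_powR. Qed.

Lemma exprz_le_powR (d x : R) (k : int) : 0 < d <= 1 -> 0 < x <= 1 -> 0 < k ->
  x ^ k <= x `^ d.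
Proof.
move=> /andP[_ d1] x01 k0; apply: le_trans (ger1_powR x01 d1); rewrite -[leRHS]expr1z.
case/andP: x01 => x0 x1.
by apply: (@ler_wpiXz2l R x (ltW x0) x1) => //; exact: ltW.
Qed.

Lemma near0_powR_le (d a : R) : 0 < d -> 0 < a -> \forall x \near at_right 0, x `^ d <= a.
Proof.
move=> d0 a0; have ad : 0 < a `^ d^-1 by exact: powR_gt0.
have aK : (a `^ d^-1) `^ d = a by rewrite -powRrM mulVf ?gt_eqF // powRr1 // ltW.
apply: near_at_right0 ad _ => x /andP[x0 xa]; rewrite -[leRHS]aK.
by apply: (ge0_ler_powR (ltW d0)) xa; rewrite nnegrE ?powR_ge0 ?ltW.
Qed.

End NearZero.

Section Pivotal.
Variables (R : realType) (dl : R).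

Definition pivotal (n : int) (f : R -> R) :=
  exists2 c : R, 0 < c & exists2 G : R, 0 <= G &
    \forall x \near at_right 0, `|f x * x ^ (- n) - c| <= G * x `^ dl.

Definition has_pivot (f : R -> R) := exists n, pivotal n f.

Definition null_or_pivot (f : R -> R) :=
  (\forall x \near at_right 0, f x = 0) \/ has_pivot f.

Lemma pivotal_eq_near n f g : pivotal n f ->
  (\forall x \near at_right 0, f x = g x) -> pivotal n g.
Proof.
move=> [c c0 [G G0 Hf]] fg; exists c => //; exists G => //.
by move: fg Hf; apply: filterS2 => x ->.
Qed.

Lemma has_pivot_eq_near f g : has_pivot f ->
  (\forall x \near at_right 0, f x = g x) -> has_pivot g.
Proof. by move=> [n Hf] fg; exists n; exact: pivotal_eq_near Hf fg. Qed.

Lemma null_or_pivot_eq_near f g : null_or_pivot f ->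
  (\forall x \near at_right 0, f x = g x) -> null_or_pivot g.
Proof.
move=> [f0|Hf] fg; last by right; exact: has_pivot_eq_near Hf fg.
by left; move: fg f0; apply: filterS2 => x <-.
Qed.

Lemma pivotal_cst c : 0 < c -> pivotal 0 (fun=> c).
Proof.
move=> c0; exists c => //; exists 0 => //.
by apply: nearW => x; rewrite oppr0 expr0z mulr1 subrr normr0 mul0r.
Qed.

Lemma pivotal_leading_term (n : nat) f (e0 : R) : 0 < e0 -> pivotal n%:Z f ->
  exists c G e, [/\ 0 < c, 0 < G, 0 < e <= e0 &
    forall x, 0 < x <= e -> `|f x - c * x ^+ n| <= G * x `^ (n%:R + dl)].
Proof.
move=> e00 [c c0 [G G0 /near_at_right0P[e e_gt0 Hf]]].
exists c, (G + 1), (Num.min e e0); split => //; first by rewrite ltr_wpDl.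
  by rewrite lt_min e_gt0 e00 ge_min lexx orbT.
move=> x /andP[x0]; rewrite le_min => /andP[xe _].
have /Hf Hfx : 0 < x <= e by rewrite x0.
have xnK : x ^ (- n%:Z) * x ^+ n = 1.
  by rewrite -invr_expz -exprnP mulVf // expf_neq0 // gt_eqF.
have -> : f x - c * x ^+ n = (f x * x ^ (- n%:Z) - c) * x ^+ n.
  by rewrite mulrBl -mulrA xnK mulr1.
rewrite powRD ?(gt_eqF x0) ?implybT // powR_mulrn ?(ltW x0) //.
have xn0 := exprn_ge0 n (ltW x0); rewrite normrM (ger0_norm xn0).
have := mulr_ge0 (powR_ge0 x dl) xn0; nra.
Qed.

Hypothesis dl01 : 0 < dl <= 1.

Lemma pivotal_bounded n f : pivotal n f ->
  exists2 B, 0 < B & \forall x \near at_right 0, `|f x * x ^ (- n)| <= B.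
Proof.
move=> [c c0 [G G0 Hf]]; exists (c + G); first by rewrite ltr_wpDr.
have dl0 : 0 <= dl by case/andP: dl01 => /ltW.
move: Hf (near0_unit R); apply: filterS2 => x Hfx /(powR_le1 dl0) w1.
rewrite -[f x * _](subrK c) (le_trans (ler_normD _ _)) // (gtr0_norm c0) addrC lerD2l.
by rewrite (le_trans Hfx) // ler_piMr.
Qed.

Lemma pivotal_lower_bound n f : pivotal n f ->
  exists2 L, 0 < L & \forall x \near at_right 0, L <= f x * x ^ (- n).
Proof.
move=> [c c0 [G G0 Hf]]; exists (c / 2); first by rewrite divr_gt0.
set K := c / 2 / (G + 1).
have KG : K * (G + 1) = c / 2 by rewrite divfK // gt_eqF // ltr_wpDl.
have K0 : 0 < K by rewrite !divr_gt0 // ltr_wpDl.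
have dl0 : 0 < dl by case/andP: dl01.
move: Hf (near0_powR_le dl0 K0); apply: filterS2 => x Hfx xK.
have w0 : 0 <= x `^ dl := powR_ge0 _ _.
have : G * x `^ dl <= c / 2 by nra.
move/(le_trans Hfx); rewrite ler_norml => /andP[lo _].
by rewrite -(lerD2r (- c)) (le_trans _ lo) // {2}(splitr c) opprD addrA addrN add0r.
Qed.

Lemma pivotal_gt0 n f : pivotal n f -> \forall x \near at_right 0, 0 < f x.
Proof.
move=> /pivotal_lower_bound[L L0 HL].
move: HL (nbhs_right_gt (0 : R)); apply: filterS2 => x Lx x0.
have : 0 < f x * x ^ (- n) by apply: lt_le_trans Lx.
by rewrite pmulr_lgt0 // exprz_gt0.
Qed.

Lemma pivotalM n m f g : pivotal n f -> pivotal m g ->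
  pivotal (n + m) (fun x => f x * g x).
Proof.
move=> Hf Hg; have [B B0 HB] := pivotal_bounded Hg.
case: Hf => [c c0 [G G0 Hf]]; case: Hg => [d d0 [D D0 Hg]].
exists (c * d); first by rewrite mulr_gt0.
exists (G * B + c * D); first by rewrite addr_ge0 // mulr_ge0 // ltW.
near=> x; have x0 : x != 0 by near: x; exact: nbhs_right_neq.
rewrite opprD expfzDr // mulrACA.
set u := f x * x ^ (- n); set v := g x * x ^ (- m).
have -> : u * v - c * d = (u - c) * v + c * (v - d) by ring.
rewrite (le_trans (ler_normD _ _)) // normrM (normrM c) (gtr0_norm c0) mulrDl.
rewrite lerD //; last by rewrite -mulrA ler_pM2l // (near Hg x).
by rewrite mulrAC; apply: ler_pM => //; [exact: (near Hf x) | exact: (near HB x)].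
Unshelve. all: by end_near. Qed.

Lemma pivotalV n f : pivotal n f -> pivotal (- n) (fun x => (f x)^-1).
Proof.
move=> Hf; have [L L0 HL] := pivotal_lower_bound Hf.
case: Hf => [c c0 [G G0 Hf]].
exists c^-1; first by rewrite invr_gt0.
exists (G / (L * c)); first by rewrite divr_ge0 // mulr_ge0 // ltW.
move: Hf HL; apply: filterS2 => x Hfx Lx.
rewrite (_ : _ * _ = (f x * x ^ (- n))^-1); last by rewrite invfM invr_expz.
set u := f x * x ^ (- n).
have u0 : 0 < u by apply: lt_le_trans Lx.
have -> : u^-1 - c^-1 = (c - u) / (u * c) by field; rewrite ?gt_eqF.
rewrite normrM distrC normfV (gtr0_norm (mulr_gt0 u0 c0)) [leRHS]mulrAC.
rewrite ler_pM ?invr_ge0 ?(ltW (mulr_gt0 u0 c0)) //.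
by rewrite lef_pV2 ?posrE ?(mulr_gt0 u0 c0) ?(mulr_gt0 L0 c0) // ler_pM2r.
Qed.

Lemma pivotalD_eq n f g : pivotal n f -> pivotal n g ->
  pivotal n (fun x => f x + g x).
Proof.
move=> [c c0 [G G0 Hf]] [d d0 [D D0 Hg]].
exists (c + d); first by rewrite addr_gt0.
exists (G + D); first by rewrite addr_ge0.
move: Hf Hg; apply: filterS2 => x Hfx Hgx; rewrite mulrDl opprD addrACA mulrDl.
by rewrite (le_trans (ler_normD _ _)) // lerD.
Qed.

Lemma pivotalD_lt n m f g : n < m -> pivotal n f -> pivotal m g ->
  pivotal n (fun x => f x + g x).
Proof.
move=> nm [c c0 [G G0 Hf]] /pivotal_bounded[B B0 HB].
exists c => //; exists (G + B); first by rewrite addr_ge0 // ltW.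
move: Hf HB (near0_unit R); apply: filterS3 => x Hfx HBx x01.
have [x0 _] := andP x01.
have -> : (f x + g x) * x ^ (- n) - c =
    (f x * x ^ (- n) - c) + g x * x ^ (- m) * x ^ (m - n).
  by rewrite -mulrA -expfzDr ?gt_eqF // addKr mulrDl addrAC.
rewrite mulrDl (le_trans (ler_normD _ _)) // lerD // normrM.
by rewrite ler_pM // ger0_norm ?exprz_le_powR ?subr_gt0 // exprz_ge0 // ltW.
Qed.

Lemma pivotalD n m f g : pivotal n f -> pivotal m g ->
  pivotal (Num.min n m) (fun x => f x + g x).
Proof.
move=> Hf Hg; case: (ltgtP n m) => [nm|mn|nm].
- exact: pivotalD_lt Hf Hg.
- apply: (pivotal_eq_near (pivotalD_lt mn Hg Hf)).
  by apply: nearW => x; rewrite addrC.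
- by rewrite -nm in Hg; exact: pivotalD_eq.
Qed.

Lemma has_pivot_null f : has_pivot f -> null_or_pivot f.
Proof. by right. Qed.

Lemma has_pivot_gt0 f : has_pivot f -> \forall x \near at_right 0, 0 < f x.
Proof. by case=> n /pivotal_gt0. Qed.

Lemma pivotalD_null n f g : pivotal n f -> null_or_pivot g ->
  exists2 m, m <= n & pivotal m (fun x => f x + g x).
Proof.
move=> Hf [g0|[m Hg]].
  exists n => //; apply: (pivotal_eq_near Hf).
  by move: g0; apply: filterS => x ->; rewrite addr0.
by exists (Num.min n m); [rewrite ge_min lexx | exact: pivotalD].
Qed.

Lemma has_pivotD_null f g : has_pivot f -> null_or_pivot g ->
  has_pivot (fun x => f x + g x).
Proof. by move=> [n Hf] /(pivotalD_null Hf)[m _ Hfg]; exists m. Qed.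

Lemma null_has_pivotD f g : null_or_pivot f -> has_pivot g ->
  has_pivot (fun x => f x + g x).
Proof.
move=> Hf Hg; apply: (has_pivot_eq_near (has_pivotD_null Hg Hf)).
by apply: nearW => x; rewrite addrC.
Qed.

Lemma null_or_pivotD f g : null_or_pivot f -> null_or_pivot g ->
  null_or_pivot (fun x => f x + g x).
Proof.
move=> [f0|Hf] Hg; last by right; exact: has_pivotD_null.
by apply: (null_or_pivot_eq_near Hg); move: f0; apply: filterS => x ->; rewrite add0r.
Qed.

Lemma has_pivotM f g : has_pivot f -> has_pivot g -> has_pivot (fun x => f x * g x).
Proof. by move=> [n Hf] [m Hg]; exists (n + m); exact: pivotalM. Qed.

Lemma has_pivotV f : has_pivot f -> has_pivot (fun x => (f x)^-1).
Proof. by move=> [n Hf]; exists (- n); exact: pivotalV. Qed.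

Lemma null_or_pivotM f g : null_or_pivot f -> null_or_pivot g ->
  null_or_pivot (fun x => f x * g x).
Proof.
move=> [f0|Hf]; first by left; move: f0; apply: filterS => x ->; rewrite mul0r.
move=> [g0|Hg]; first by left; move: g0; apply: filterS => x ->; rewrite mulr0.
by right; exact: has_pivotM.
Qed.

Lemma has_pivot_div f g : has_pivot f -> has_pivot g -> has_pivot (fun x => f x / g x).
Proof. by move=> Hf /has_pivotV; exact: has_pivotM. Qed.

Lemma null_or_pivot_div f g : null_or_pivot f -> has_pivot g ->
  null_or_pivot (fun x => f x / g x).
Proof. by move=> Hf /has_pivotV/has_pivot_null; exact: null_or_pivotM. Qed.

Lemma null_or_pivot_sum (I : Type) {s : seq I} (P : pred I) (F : I -> R -> R) :
  (forall i, P i -> null_or_pivot (F i)) ->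
  null_or_pivot (fun x => \sum_(i <- s | P i) F i x).
Proof.
move=> HF; elim: s => [|i s IH]; first by left; apply: nearW => x; rewrite big_nil.
case Pi: (P i); last first.
  by apply: (null_or_pivot_eq_near IH); apply: nearW => x; rewrite big_cons Pi.
apply: (null_or_pivot_eq_near (null_or_pivotD (HF i Pi) IH)).
by apply: nearW => x; rewrite big_cons Pi.
Qed.

Lemma has_pivot_sum (I : finType) (B : {set I}) (i0 : I) (F : I -> R -> R) :
  i0 \in B -> has_pivot (F i0) -> (forall i, i \in B -> null_or_pivot (F i)) ->
  has_pivot (fun x => \sum_(i in B) F i x).
Proof.
move=> i0B Hi0 HF.
have Hrest : null_or_pivot (fun x => \sum_(i in B | i != i0) F i x).
  by apply: null_or_pivot_sum => i /andP[iB _]; exact: HF.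
apply: (has_pivot_eq_near (has_pivotD_null Hi0 Hrest)).
by apply: nearW => x; rewrite [in RHS](bigD1 i0).
Qed.

Lemma pivotal_expansion f (n0 : int) (K : nat) (a : nat -> R) (G d : R) :
  dl <= d -> 0 < a 0%N -> 0 <= G ->
  (\forall x \near at_right 0,
     `|f x - \sum_(k < K.+1) a k * x ^ (n0 + k%:Z)| <= G * (x ^ (n0 + K%:Z) * x `^ d)) ->
  pivotal n0 f.
Proof.
move=> dld a0 G0 Hf; exists (a 0%N) => //.
exists (G + \sum_(k < K) `|a k.+1|); first by rewrite addr_ge0 // sumr_ge0.
move: Hf (near0_unit R); apply: filterS2 => x Hfx x01.
have [x0 x1] := andP x01; have xn0 : x != 0 by rewrite gt_eqF.
have xn0K (k : nat) : x ^ (n0 + k%:Z) * x ^ (- n0) = x ^+ k.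
  by rewrite -expfzDr // addrAC subrr add0r.
set S := \sum_(k < K.+1) a k * x ^ (n0 + k%:Z).
have -> : f x * x ^ (- n0) - a 0%N =
    (f x - S) * x ^ (- n0) + \sum_(k < K) a k.+1 * x ^+ k.+1.
  rewrite mulrBl mulr_suml big_ord_recl -mulrA xn0K expr0 mulr1.
  under eq_bigr do rewrite -mulrA xn0K.
  by rewrite opprD addrA subrK.
rewrite [leRHS]mulrDl (le_trans (ler_normD _ _)) // lerD //.
  rewrite normrM (gtr0_norm (exprz_gt0 _ x0)).
  apply: le_trans (ler_wpM2r (ltW (exprz_gt0 _ x0)) Hfx) _.
  rewrite -mulrA mulrAC xn0K ler_wpM2l // (le_trans _ (ger_powR x01 dld)) //.
  by rewrite ler_piMl ?powR_ge0 ?exprn_ile1 // (ltW x0).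
rewrite mulr_suml (le_trans (ler_norm_sum _ _ _)) // ler_sum // => k _.
rewrite normrM ler_wpM2l // ger0_norm ?exprn_ge0 ?(ltW x0) //.
exact: (exprz_le_powR (k := k.+1%:Z)).
Qed.

Lemma pivotal_nat_expansion f (lm lp : nat) (a : nat -> R) (G d : R) :
  dl <= d -> (lm <= lp)%N -> 0 < a lm -> 0 <= G ->
  (\forall x \near at_right 0,
     `|f x - \sum_(lm <= l < lp.+1) a l * x ^+ l| <= G * x `^ (lp%:R + d)) ->
  pivotal lm%:Z f.
Proof.
move=> dld lmp a0 G0 Hf.
have a0' : 0 < a (lm + 0)%N by rewrite addn0.
apply: (pivotal_expansion (K := lp - lm) (a := fun k => a (lm + k)%N) dld a0' G0).
move: Hf (nbhs_right_gt (0 : R)); apply: filterS2 => x Hfx x0.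
rewrite -PoszD subnKC // -exprnP -powR_mulrn ?(ltW x0) // -powRD ?(gt_eqF x0) ?implybT //.
rewrite -{1}[lm]add0n big_addn subSn // big_mkord in Hfx.
by under eq_bigr do rewrite -PoszD addnC -exprnP.
Qed.

Lemma pivotal_int_expansion f (mm mp : int) (b : int -> R) (G d : R) :
  dl <= d -> mm <= mp -> 0 < b mm -> 0 <= G ->
  (\forall x \near at_right 0,
     `|f x - \sum_(0 <= k < `|mp - mm|%N.+1) b (mm + k%:Z) * x ^ (mm + k%:Z)|
       <= G * x `^ (mp%:~R + d)) ->
  pivotal mm f.
Proof.
move=> dld mmp b0 G0 Hf.
have b0' : 0 < b (mm + 0%N%:Z) by rewrite addr0.
apply: (pivotal_expansion (K := `|mp - mm|%N) (a := fun k => b (mm + k%:Z)) dld b0' G0).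
move: Hf (nbhs_right_gt (0 : R)); apply: filterS2 => x Hfx x0.
rewrite big_mkord in Hfx.
rewrite gez0_abs ?subr_ge0 // (addrC mm) subrK.
by rewrite -powR_intmul ?(ltW x0) // -powRD ?(gt_eqF x0) ?implybT.
Qed.

End Pivotal.

Section Censoring.
Variables (F : fieldType) (S : finType).
Implicit Types (Q : S -> S -> F) (f g : S -> F) (A : {set S}) (r k : S).

Definition defect Q A k := 1 - \sum_(j in A) Q k j.

(* Eliminating state r (the chain watched only off r), i.e. one step of
   Gaussian elimination on the system g = f + Q g. *)
Definition censor Q r k j := Q k j + Q k r / (1 - Q r r) * Q r j.

Definition censor_rhs Q f r k := f k + Q k r / (1 - Q r r) * f r.

Definition censor_ext Q f A r g k :=
  if k == r then (f r + \sum_(j in A :\ r) Q r j * g j) / (1 - Q r r) else g k.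

Lemma sum_setC1 i (G : S -> F) : \sum_k G k = G i + \sum_(k in [set~ i]) G k.
Proof. by rewrite (bigD1 i) //; congr (_ + _); apply: eq_bigl => k; rewrite in_setC1. Qed.

Lemma defect_setC1 Q i k : \sum_j Q k j = 1 -> defect Q [set~ i] k = Q k i.
Proof. by move=> Q1; rewrite /defect -Q1 (sum_setC1 i) addrK. Qed.

Lemma sum_censor A Q r k (g : S -> F) :
  \sum_(j in A) censor Q r k j * g j =
  \sum_(j in A) Q k j * g j + Q k r / (1 - Q r r) * \sum_(j in A) Q r j * g j.
Proof. by rewrite mulr_sumr -big_split; apply: eq_bigr => j _; rewrite mulrDl mulrA. Qed.

Lemma defect_setD1 Q A r : r \in A ->
  defect Q A r + \sum_(j in A :\ r) Q r j = 1 - Q r r.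
Proof. by move=> rA; rewrite /defect (big_setD1 _ rA) opprD addrA subrK. Qed.

Lemma defect_censor Q A r k : r \in A -> 1 - Q r r != 0 ->
  defect (censor Q r) (A :\ r) k =
  defect Q A k + Q k r / (1 - Q r r) * defect Q A r.
Proof.
move=> rA Dr; rewrite /defect /censor big_split /= -mulr_sumr !(big_setD1 _ rA) /=.
by field.
Qed.

Lemma censor_ext_solution Q f A r g : r \in A -> 1 - Q r r != 0 ->
  (forall k, k \in A :\ r ->
     g k = censor_rhs Q f r k + \sum_(j in A :\ r) censor Q r k j * g j) ->
  forall k, k \in A ->
    censor_ext Q f A r g k = f k + \sum_(j in A) Q k j * censor_ext Q f A r g j.
Proof.
move=> rA Dr Hg k kA.
have hr : censor_ext Q f A r g r =
    (f r + \sum_(j in A :\ r) Q r j * g j) / (1 - Q r r) by rewrite /censor_ext eqxx.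
have hA' j : j \in A :\ r -> censor_ext Q f A r g j = g j.
  by rewrite in_setD1 /censor_ext => /andP[/negbTE ->].
rewrite (big_setD1 _ rA) /= hr.
under eq_bigr => j jA' do rewrite (hA' j jA').
case: (eqVneq k r) => [->|kr]; first by rewrite hr; field.
rewrite /censor_ext (negbTE kr) (Hg k) ?in_setD1 ?kr // sum_censor /censor_rhs.
by field.
Qed.

End Censoring.

Definition escapable (R : realType) (dl : R) (S : finType) (A : {set S})
    (Q : R -> S -> S -> R) :=
  forall (B : {set S}) b, B \subset A -> b \in B -> exists2 k, k \in B &
    has_pivot dl (fun x => defect (Q x) A k) \/
    exists2 j, j \in A :\: B & has_pivot dl (fun x => Q x k j).

Section EscapableCensoring.
Variables (R : realType) (dl : R) (S : finType) (A : {set S}) (Q : R -> S -> S -> R).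
Variable r : S.
Hypothesis dl01 : 0 < dl <= 1.
Hypothesis rA : r \in A.
Hypothesis HQ : forall k j, k \in A -> j \in A -> null_or_pivot dl (fun x => Q x k j).
Hypothesis Hdefect : forall k, k \in A -> null_or_pivot dl (fun x => defect (Q x) A k).
Hypothesis Hesc : escapable dl A Q.

Let sub_r j : j \in A :\ r -> j \in A.
Proof. by rewrite in_setD1 => /andP[]. Qed.

Lemma has_pivot_stay : has_pivot dl (fun x => 1 - Q x r r).
Proof.
have rsub : [set r] \subset A by rewrite finset.sub1set.
have [k] := Hesc rsub (set11 r); rewrite finset.in_set1 => /eqP -> {k} [Hr|[j jAr Hj]].
  have Hrest : null_or_pivot dl (fun x => \sum_(j in A :\ r) Q x r j).
    by apply: (null_or_pivot_sum dl01) => i /sub_r; exact: HQ.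
  apply: (has_pivot_eq_near (has_pivotD_null dl01 Hr Hrest)).
  by apply: nearW => x; rewrite defect_setD1.
have Hrest : has_pivot dl (fun x => \sum_(j in A :\ r) Q x r j).
  by apply: (has_pivot_sum dl01 jAr Hj) => i /sub_r; exact: HQ.
apply: (has_pivot_eq_near (null_has_pivotD dl01 (Hdefect rA) Hrest)).
by apply: nearW => x; rewrite defect_setD1.
Qed.

Let weight k : k \in A -> null_or_pivot dl (fun x => Q x k r / (1 - Q x r r)).
Proof. by move=> kA; exact: (null_or_pivot_div dl01 (HQ kA rA) has_pivot_stay). Qed.

Let stay_neq0 : \forall x \near at_right 0, 1 - Q x r r != 0.
Proof. by move: (has_pivot_gt0 dl01 has_pivot_stay); apply: filterS => x /lt0r_neq0. Qed.

Lemma null_or_pivot_censor k j : k \in A :\ r -> j \in A :\ r ->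
  null_or_pivot dl (fun x => censor (Q x) r k j).
Proof.
move=> /sub_r kA /sub_r jA; rewrite /censor.
exact: (null_or_pivotD dl01 (HQ kA jA) (null_or_pivotM dl01 (weight kA) (HQ rA jA))).
Qed.

Lemma null_or_pivot_censor_defect k : k \in A :\ r ->
  null_or_pivot dl (fun x => defect (censor (Q x) r) (A :\ r) k).
Proof.
move=> /sub_r kA; apply: (null_or_pivot_eq_near
  (null_or_pivotD dl01 (Hdefect kA) (null_or_pivotM dl01 (weight kA) (Hdefect rA)))).
by move: stay_neq0; apply: filterS => x Dx; rewrite defect_censor.
Qed.

Lemma has_pivot_censor_rhs (f : R -> S -> R) :
  (forall k, k \in A -> has_pivot dl (fun x => f x k)) ->
  forall k, k \in A :\ r -> has_pivot dl (fun x => censor_rhs (Q x) (f x) r k).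
Proof.
move=> Hf k /sub_r kA; rewrite /censor_rhs.
have Hfr := has_pivot_null (Hf r rA).
exact: (has_pivotD_null dl01 (Hf k kA) (null_or_pivotM dl01 (weight kA) Hfr)).
Qed.

Lemma has_pivot_censor k j : k \in A :\ r -> j \in A :\ r ->
  has_pivot dl (fun x => Q x k j) \/
    has_pivot dl (fun x => Q x k r) /\ has_pivot dl (fun x => Q x r j) ->
  has_pivot dl (fun x => censor (Q x) r k j).
Proof.
move=> /sub_r kA /sub_r jA; rewrite /censor => -[Hkj|[Hkr Hrj]].
  exact: (has_pivotD_null dl01 Hkj (null_or_pivotM dl01 (weight kA) (HQ rA jA))).
apply: (null_has_pivotD dl01 (HQ kA jA) (has_pivotM dl01 _ Hrj)).
exact: (has_pivot_div dl01 Hkr has_pivot_stay).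
Qed.

Lemma has_pivot_censor_defect k : k \in A :\ r ->
  has_pivot dl (fun x => defect (Q x) A k) \/
    has_pivot dl (fun x => Q x k r) /\ has_pivot dl (fun x => defect (Q x) A r) ->
  has_pivot dl (fun x => defect (censor (Q x) r) (A :\ r) k).
Proof.
move=> /sub_r kA Hk.
have Hsum : has_pivot dl
    (fun x => defect (Q x) A k + Q x k r / (1 - Q x r r) * defect (Q x) A r).
  case: Hk => [Hk|[Hkr Hr]].
    exact: (has_pivotD_null dl01 Hk (null_or_pivotM dl01 (weight kA) (Hdefect rA))).
  apply: (null_has_pivotD dl01 (Hdefect kA) (has_pivotM dl01 _ Hr)).
  exact: (has_pivot_div dl01 Hkr has_pivot_stay).
apply: (has_pivot_eq_near Hsum).
by move: stay_neq0; apply: filterS => x Dx; rewrite defect_censor.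
Qed.

(* If B can only be left towards r, use escapability of r |: B: either r
   itself leaks, or it leads out of r |: B, and both routes survive censoring. *)
Lemma escapable_censor : escapable dl (A :\ r) (fun x => censor (Q x) r).
Proof.
move=> B b BA' bB; have inA' := fintype.subsetP BA'.
have BA : B \subset A := fintype.subset_trans BA' (subD1set A r).
have outA' j : j \in (A :\ r) :\: B -> j \in A :\ r by rewrite inE => /andP[].
have [k kB [Hk|[j jAB Hkj]]] := Hesc BA bB.
  by exists k => //; left; apply: has_pivot_censor_defect; [exact: inA' | left].
have [jr|jr] := eqVneq j r; last first.
  have jA'B : j \in (A :\ r) :\: B by move: jAB; rewrite !inE jr.
  exists k => //; right; exists j => //.
  by apply: has_pivot_censor; [exact: inA' | exact: outA' | left].
rewrite {j jAB}jr in Hkj.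
have rBA : r |: B \subset A by rewrite finset.subUset finset.sub1set rA BA.
have out j : j \in A :\: (r |: B) -> j \in (A :\ r) :\: B.
  by rewrite finset.setDDl finset.setUC.
have [k' /setU1P[->|k'B] [Hk'|[j' /out j'A'B Hj']]] := Hesc rBA (setU11 r B).
- by exists k => //; left; apply: has_pivot_censor_defect; [exact: inA' | right].
- exists k => //; right; exists j' => //.
  by apply: has_pivot_censor; [exact: inA' | exact: outA' | right].
- by exists k' => //; left; apply: has_pivot_censor_defect; [exact: inA' | left].
- exists k' => //; right; exists j' => //.
  by apply: has_pivot_censor; [exact: inA' | exact: outA' | left].
Qed.

End EscapableCensoring.

Lemma escapable_solution (R : realType) (dl : R) (S : finType) (A : {set S})
    (Q : R -> S -> S -> R) (f : R -> S -> R) :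
  0 < dl <= 1 ->
  (forall k j, k \in A -> j \in A -> null_or_pivot dl (fun x => Q x k j)) ->
  (forall k, k \in A -> null_or_pivot dl (fun x => defect (Q x) A k)) ->
  escapable dl A Q ->
  (forall k, k \in A -> has_pivot dl (fun x => f x k)) ->
  exists h : R -> S -> R,
    (\forall x \near at_right 0, forall k, k \in A ->
       h x k = f x k + \sum_(j in A) Q x k j * h x j) /\
    forall k, k \in A -> has_pivot dl (fun x => h x k).
Proof.
move=> dl01; move Hn : #|A| => n.
elim: n A Q f Hn => [|n IH] A Q f cardA HQ Hdefect Hesc Hf.
  by exists (fun _ _ => 0); split; [apply: nearW => x k | move=> k];
    rewrite (card0_eq cardA).
have /card_gt0P[r rA] : (0 < #|A|)%N by rewrite cardA.
have cardA' : #|A :\ r| = n by move: cardA; rewrite (cardsD1 r A) rA add1n => -[].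
have [h' [Hh' Hpiv']] := IH _ _ _ cardA' (null_or_pivot_censor dl01 rA HQ Hdefect Hesc)
  (null_or_pivot_censor_defect dl01 rA HQ Hdefect Hesc)
  (escapable_censor dl01 rA HQ Hdefect Hesc)
  (has_pivot_censor_rhs dl01 rA HQ Hdefect Hesc Hf).
have stay := has_pivot_stay dl01 rA HQ Hdefect Hesc.
exists (fun x => censor_ext (Q x) (f x) A r (h' x)); split.
  move: Hh' (has_pivot_gt0 dl01 stay); apply: filterS2 => x Hx Dx.
  exact: (censor_ext_solution rA (lt0r_neq0 Dx) Hx).
move=> k kA; rewrite /censor_ext; case: (eqVneq k r) => [_|kr]; last first.
  by apply: Hpiv'; rewrite in_setD1 kr.
apply: (has_pivot_div dl01 _ stay); apply: (has_pivotD_null dl01 (Hf r rA)).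
apply: (null_or_pivot_sum dl01) => j jA'.
have jA : j \in A by move: jA'; rewrite in_setD1 => /andP[].
exact: (null_or_pivotM dl01 (HQ r j rA jA) (has_pivot_null (Hpiv' j jA'))).
Qed.

Section ReturnTime.
Variables (R : realType) (N : nat) (P Em : 'I_N -> 'I_N -> R) (i : 'I_N).

Lemma taboo_succ_at n : taboo P i n.+1 i = 0.
Proof. by rewrite /= eqxx mul0r. Qed.

Hypothesis P_ge0 : forall k j, 0 <= P k j.

Lemma taboo_ge0 n k : 0 <= taboo P i n k.
Proof.
elim: n k => [|n IH] k /=; first exact: ler0n.
by rewrite mulr_ge0 ?ler0n // sumr_ge0 // => m _; rewrite mulr_ge0.
Qed.

Variable h : 'I_N -> R.
Hypothesis h_eq : forall k, k \in [set~ i] ->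
  h k = esoj Em k + \sum_(j in [set~ i]) P k j * h j.

Let t : R ^nat := fun n => \sum_(k < N) taboo P i n k * esoj Em k.
Let rest n := \sum_(k in [set~ i]) taboo P i n k * h k.

Let sum_taboo_succ n (F : 'I_N -> R) :
  \sum_k taboo P i n.+1 k * F k = \sum_(k in [set~ i]) taboo P i n.+1 k * F k.
Proof. by rewrite (sum_setC1 i) taboo_succ_at mul0r add0r. Qed.

Let rest_succ n : t n.+1 + rest n.+2 = rest n.+1.
Proof.
have -> : rest n.+2 = \sum_(m in [set~ i]) taboo P i n.+1 m *
    \sum_(k in [set~ i]) P m k * h k.
  rewrite -sum_taboo_succ; under eq_bigr do rewrite mulr_sumr.
  rewrite exchange_big /rest; apply: eq_bigr => k; rewrite in_setC1 => ki.
  by rewrite /= ki mul1r mulr_suml; apply: eq_bigr => m _; rewrite mulrA.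
rewrite /t sum_taboo_succ -big_split /=; apply: eq_bigr => k ki.
by rewrite -mulrDr -h_eq.
Qed.

(* The first n + 1 sojourns before the return to i, plus the expected
   remaining time from where the chain stands, account for all of E_ii. *)
Lemma taboo_series n :
  series t n.+1 + rest n.+1 = esoj Em i + \sum_(k in [set~ i]) P i k * h k.
Proof.
elim: n => [|n IH].
  rewrite seriesS /series /= big_geq // addr0 /t (sum_setC1 i) /= eqxx mul1r.
  rewrite big1 ?addr0; last first.
    by move=> k; rewrite in_setC1 => /negbTE ->; rewrite mul0r.
  congr (_ + _); apply: eq_bigr => k; rewrite in_setC1 => ki.
  rewrite /= ki mul1r (bigD1 i) //= eqxx mul1r big1 ?addr0 //.
  by move=> m /negbTE ->; rewrite mul0r.
by rewrite seriesSr -addrA rest_succ.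
Qed.

Hypothesis e_gt0 : forall k, 0 < esoj Em k.
Hypothesis h_ge0 : forall k, k \in [set~ i] -> 0 <= h k.

Lemma ret_time_solution :
  ret_time P Em i = esoj Em i + \sum_(k in [set~ i]) P i k * h k.
Proof.
set T := _ + _; have TE n : series t n.+1 + rest n.+1 = T := taboo_series n.
have t_ge0 n : 0 <= t n.
  by apply: sumr_ge0 => k _; rewrite mulr_ge0 ?taboo_ge0 // ltW.
have rest_ge0 n : 0 <= rest n.
  by apply: sumr_ge0 => k ki; rewrite mulr_ge0 ?taboo_ge0 ?h_ge0.
have cvg_series : cvgn (series t).
  apply: nondecreasing_is_cvgn.
    by rewrite seriesEnat; apply: nondecreasing_series => n _ _.
  exists T => _ [n _ <-].
  by rewrite -(TE n) seriesSr -addrA lerDl addr_ge0.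
set C := \sum_(k in [set~ i]) h k / esoj Em k.
have rest_le n : rest n.+1 <= C * t n.+1.
  rewrite /t sum_taboo_succ /rest mulr_sumr; apply: ler_sum => k ki.
  have ek := e_gt0 k.
  rewrite (_ : _ * h k = taboo P i n.+1 k * esoj Em k * (h k / esoj Em k)); last first.
    by field; rewrite gt_eqF.
  rewrite [leLHS]mulrC; apply: ler_wpM2r; first by rewrite mulr_ge0 ?taboo_ge0 ?(ltW ek).
  rewrite /C (bigD1 k) // lerDl sumr_ge0 // => j /andP[ji _].
  by rewrite divr_ge0 ?h_ge0 ?ltW.
have rest_cvg0 : ((fun n => rest n.+1) @ \oo --> 0)%classic.
  apply: (@squeeze_cvgr _ _ _ _ (fun=> 0) (fun n => C * t n.+1)).
  - by apply: nearW => n; rewrite rest_ge0 rest_le.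
  - exact: cvg_cst.
  - rewrite -(mulr0 C); apply: cvgMr.
    by have := cvg_series_cvg_0 cvg_series; rewrite -cvg_shiftS.
apply: cvg_lim => //; rewrite -cvg_shiftS.
have -> : (fun n => series t n.+1) = (fun n => T - rest n.+1).
  by apply: funext => n; rewrite -(TE n) addrK.
have lim_T := cvgB (cvg_cst T) rest_cvg0; rewrite subr0 in lim_T; exact: lim_T.
Qed.

End ReturnTime.

Lemma escapable_irreducible (R : realType) (dl : R) (S : finType)
    (P : R -> S -> S -> R) (Y : S -> {set S}) (i : S) :
  (\forall x \near at_right 0, forall k, \sum_j P x k j = 1) ->
  (forall k j, j \in Y k -> has_pivot dl (fun x => P x k j)) ->
  (forall k j, exists (n : nat) (l : nat -> S), [/\ (0 < n)%N, l 0%N = k, l n = j &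
      forall m, (0 < m <= n)%N -> l m \in Y (l m.-1)]) ->
  escapable dl [set~ i] P.
Proof.
move=> rows Hpiv Hirr B b BA bB.
have [n [l [n0 l0 ln Hl]]] := Hirr b i.
have iB : i \notin B by apply/negP => /(fintype.subsetP BA); rewrite in_setC1 eqxx.
have exit_B : exists m, l m \notin B by exists n; rewrite ln.
have [m lm_out m_min] := ex_minnP exit_B.
have m0 : (0 < m)%N by case: m lm_out m_min => //; rewrite l0 bB.
have lm1B : l m.-1 \in B.
  by apply: contraT => /m_min; rewrite -ltnS prednK // ltnn.
have edge : l m \in Y (l m.-1) by apply: Hl; rewrite m0 m_min // ln.
exists (l m.-1) => //; case: (eqVneq (l m) i) => [lmi|lmi].
  left; apply: (has_pivot_eq_near (Hpiv _ _ edge)); rewrite lmi.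
  by move: rows; apply: filterS => x rows; rewrite defect_setC1.
by right; exists (l m); [rewrite !inE lm_out lmi | exact: Hpiv].
Qed.

Lemma stat_prob_pivotal (R : realType) (dl : R) (N : nat) (p e : R -> 'I_N -> 'I_N -> R)
    (i : 'I_N) :
  0 < dl <= 1 ->
  (\forall x \near at_right 0, forall k j, 0 <= p x k j) ->
  (\forall x \near at_right 0, forall k, \sum_j p x k j = 1) ->
  (forall k j, null_or_pivot dl (fun x => p x k j)) ->
  (forall k, has_pivot dl (fun x => esoj (e x) k)) ->
  escapable dl [set~ i] p ->
  exists n : nat, pivotal dl n%:Z (fun x => stat_prob (p x) (e x) i).
Proof.
move=> dl01 p_ge0 rows Hp He Hesc.
have Hdefect k : k \in [set~ i] -> null_or_pivot dl (fun x => defect (p x) [set~ i] k).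
  move=> _; apply: (null_or_pivot_eq_near (Hp k i)).
  by move: rows; apply: filterS => x rows; rewrite defect_setC1.
have [h [Hh Hpiv]] := escapable_solution (f := fun x k => esoj (e x) k) dl01
  (fun k j _ _ => Hp k j) Hdefect Hesc (fun k _ => He k).
pose s x := \sum_(k in [set~ i]) p x i k * h x k.
have Hs : null_or_pivot dl s.
  apply: (null_or_pivot_sum dl01) => k ki.
  exact: (null_or_pivotM dl01 (Hp i k) (has_pivot_null (Hpiv k ki))).
have Hs_e := null_or_pivot_div dl01 Hs (He i).
have [m m_le0 Hm] := pivotalD_null dl01 (pivotal_cst dl ltr01) Hs_e.
exists `|- m|%N; rewrite gez0_abs ?oppr_ge0 //.
apply: (pivotal_eq_near (pivotalV dl01 Hm)); near=> x.
have e_gt0 : forall k, 0 < esoj (e x) k.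
  by near: x; apply: filter_forall => k; exact: (has_pivot_gt0 dl01 (He k)).
have h_ge0 : forall k, k \in [set~ i] -> 0 <= h x k.
  near: x; apply: near_forall_in => k ki.
  by move: (has_pivot_gt0 dl01 (Hpiv k ki)); apply: filterS => x /ltW.
have p_ge0x : forall k j, 0 <= p x k j by near: x.
have Hhx : forall k, k \in [set~ i] ->
    h x k = esoj (e x) k + \sum_(j in [set~ i]) p x k j * h x j by near: x.
rewrite /stat_prob (ret_time_solution p_ge0x Hhx e_gt0 h_ge0) -/(s x).
by rewrite -[1](divff (lt0r_neq0 (e_gt0 i))) -mulrDl invf_div.
Unshelve. all: by end_near. Qed.

Lemma stat_prob_pivotal_irreducible (R : realType) (dl : R) (N : nat)
    (p e : R -> 'I_N -> 'I_N -> R) (Y : 'I_N -> {set 'I_N}) (i : 'I_N) :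
  0 < dl <= 1 ->
  (\forall x \near at_right 0, forall k j, 0 <= p x k j) ->
  (\forall x \near at_right 0, forall k, \sum_j p x k j = 1) ->
  (\forall x \near at_right 0, forall k j, j \notin Y k -> p x k j = 0 /\ e x k j = 0) ->
  (forall k, Y k != finset.set0) ->
  (forall k j, j \in Y k ->
     has_pivot dl (fun x => p x k j) /\ has_pivot dl (fun x => e x k j)) ->
  (forall k j, exists (n : nat) (l : nat -> 'I_N), [/\ (0 < n)%N, l 0%N = k, l n = j &
      forall m, (0 < m <= n)%N -> l m \in Y (l m.-1)]) ->
  exists n : nat, pivotal dl n%:Z (fun x => stat_prob (p x) (e x) i).
Proof.
move=> dl01 p_ge0 rows offY Yne pivots irr.
have null_pe k j :
    null_or_pivot dl (fun x => p x k j) /\ null_or_pivot dl (fun x => e x k j).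
  have [/pivots[/has_pivot_null ? /has_pivot_null ?] //|jY] := boolP (j \in Y k).
  by split; left; move: offY; apply: filterS => x /(_ k j jY)[].
apply: (stat_prob_pivotal dl01 p_ge0 rows (fun k j => proj1 (null_pe k j))).
  move=> k; have /set0Pn[j0 j0Y] := Yne k.
  apply: (has_pivot_eq_near (has_pivot_sum dl01 (F := fun j x => e x k j)
    (finset.in_setT j0) (proj2 (pivots k j0 j0Y)) (fun j _ => proj2 (null_pe k j)))).
  by apply: nearW => x; apply: eq_bigl => j; rewrite finset.in_setT.
exact: (escapable_irreducible rows (fun k j jY => proj1 (pivots k j jY)) irr).
Qed.

Section DeltaStar.
Variables (R : realType) (N : nat) (Y : 'I_N -> {set 'I_N}) (d dd : 'I_N -> 'I_N -> R).

Lemma delta_star_gt0 : (forall k j, j \in Y k -> 0 < d k j /\ 0 < dd k j) ->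
  0 < delta_star Y d dd.
Proof.
move=> H; apply: lt_bigmin => // k _; apply: lt_bigmin => // j /H[dkj ddkj].
by rewrite lt_min dkj ddkj.
Qed.

Lemma delta_star_le1 : delta_star Y d dd <= 1.
Proof. exact: bigmin_le_id. Qed.

Lemma delta_star_le k j : j \in Y k ->
  delta_star Y d dd <= d k j /\ delta_star Y d dd <= dd k j.
Proof.
move=> jY; suff : delta_star Y d dd <= Num.min (d k j) (dd k j) by rewrite le_min => /andP.
apply: (@le_trans _ _ (\big[Num.min/1]_(j in Y k) Num.min (d k j) (dd k j))).
  exact: bigmin_le.
exact: bigmin_le_cond.
Qed.

End DeltaStar.

Theorem theorem4 (R : realType) (N : nat) (eps0 : R)
  (p e : R -> 'I_N -> 'I_N -> R)
  (Y : 'I_N -> {set 'I_N})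
  (lm lp : 'I_N -> 'I_N -> nat) (a : 'I_N -> 'I_N -> nat -> R)
  (d G epsp : 'I_N -> 'I_N -> R)
  (mm mp : 'I_N -> 'I_N -> int) (b : 'I_N -> 'I_N -> int -> R)
  (dd dG epse : 'I_N -> 'I_N -> R) :
  0 < eps0 -> eps0 <= 1 ->
  (* standing conditions: p, e come from semi-Markov kernels Q^(eps) *)
  (forall eps, 0 < eps <= eps0 -> forall i j,
      0 <= p eps i j /\ 0 <= e eps i j /\ (p eps i j = 0 -> e eps i j = 0)) ->
  (forall eps, 0 < eps <= eps0 -> forall i, \sum_(j < N) p eps i j = 1) ->
  (* condition A *)
  (forall i, Y i != finset.set0) ->
  (forall eps, 0 < eps <= eps0 -> forall i j, j \in Y i -> 0 < p eps i j) ->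
  (forall eps, 0 < eps <= eps0 -> forall i j, j \notin Y i -> p eps i j = 0) ->
  (forall i j, exists (n : nat) (l : nat -> 'I_N),
      [/\ (0 < n)%N, l 0%N = i, l n = j &
          forall m, (0 < m <= n)%N -> l m \in Y (l m.-1)]) ->
  (* condition D' *)
  (forall i j, j \in Y i ->
     [/\ (lm i j <= lp i j)%N, 0 < a i j (lm i j),
         [/\ 0 < d i j <= 1 & 0 < G i j], 0 < epsp i j <= eps0 &
         forall eps, 0 < eps <= epsp i j ->
           `| p eps i j - \sum_(lm i j <= l < (lp i j).+1) a i j l * eps ^+ l |
             <= G i j * powR eps ((lp i j)%:R + d i j)]) ->
  (* condition E' *)
  (forall i j, j \in Y i ->
     [/\ mm i j <= mp i j, 0 < b i j (mm i j),
         [/\ 0 < dd i j <= 1 & 0 < dG i j], 0 < epse i j <= eps0 &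
         forall eps, 0 < eps <= epse i j ->
           `| e eps i j - \sum_(0 <= k < `|mp i j - mm i j|%N.+1)
                            b i j (mm i j + k%:Z) * eps ^ (mm i j + k%:Z) |
             <= dG i j * powR eps ((mp i j)%:~R + dd i j)]) ->
  forall i : 'I_N,
  exists (nm np : nat) (c : nat -> R) (Gs epsi : R),
    [/\ (nm <= np)%N, c nm != 0, 0 < Gs, 0 < epsi <= eps0 &
        forall eps, 0 < eps <= epsi ->
          `| stat_prob (p eps) (e eps) i - \sum_(nm <= l < np.+1) c l * eps ^+ l |
            <= Gs * powR eps (np%:R + delta_star Y d dd)].
Proof.
move=> eps00 _ Hst Hrow HYne _ HY0 Hirr HD HE i.
set dl := delta_star Y d dd.
have dl01 : 0 < dl <= 1.
  rewrite delta_star_le1 andbT; apply: delta_star_gt0 => k j jY.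
  have [_ _ [/andP[-> _] _] _ _] := HD k j jY.
  by have [_ _ [/andP[-> _] _] _ _] := HE k j jY.
have near_eps0 := near_at_right0 eps00.
have pivots k j : j \in Y k ->
    has_pivot dl (fun x => p x k j) /\ has_pivot dl (fun x => e x k j).
  move=> jY; have [dl_d dl_dd] : dl <= d k j /\ dl <= dd k j by exact: delta_star_le.
  have [lmp a0 [_ G0] /andP[ep0 _] Hp] := HD k j jY.
  have [mmp b0 [_ dG0] /andP[ep0' _] He] := HE k j jY.
  split; [exists (lm k j)%:Z | exists (mm k j)].
    exact: (pivotal_nat_expansion dl01 dl_d lmp a0 (ltW G0) (near_at_right0 ep0 Hp)).
  exact: (pivotal_int_expansion dl01 dl_dd mmp b0 (ltW dG0) (near_at_right0 ep0' He)).
have offY : \forall x \near at_right 0,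
    forall k j, j \notin Y k -> p x k j = 0 /\ e x k j = 0.
  apply: near_eps0 => x x_eps k j jY; have p0 := HY0 x x_eps k j jY.
  by have [_ [_ pe]] := Hst x x_eps k j; split; last exact: pe.
have p_ge0 : \forall x \near at_right 0, forall k j, 0 <= p x k j.
  by apply: near_eps0 => x x_eps k j; have [] := Hst x x_eps k j.
have [n Hn] := stat_prob_pivotal_irreducible i dl01 p_ge0 (near_eps0 _ Hrow) offY HYne
  pivots Hirr.
have [c [Gs [epsi [c0 Gs0 epsi_le Hbound]]]] := pivotal_leading_term eps00 Hn.
exists n, n, (fun=> c), Gs, epsi; split => //; first by rewrite gt_eqF.
by move=> x /Hbound; rewrite big_nat1.
Qed.
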